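(* Let $\mu$ be a Borel probability measure on the unit circle $\mathbb{T}$, identified with $[0,1)$. Then for all real numbers $0<a<b\leq 1$, $$\mu[a,b)=\frac{1}{\pi}\sum_{n=1}^\infty \Im\left(\frac{\hat{\mu}(n)-1}{n}\,[e(nb)-e(na)]\right)+\lim_{n\to \infty}\frac{1}{2n}\sum_{j=1}^n (\hat{\mu}(j)-1)\,[e(ja)-e(jb)].$$ Moreover, for every $0<b\leq 1$, $$\mu[0,b)=1+\frac{1}{\pi}\sum_{n=1}^\infty \Im\left(\frac{\hat{\mu}(n)-1}{n}\,[e(nb)-1]\right)+\lim_{n\to \infty}\frac{1}{2n}\sum_{j=1}^n (\hat{\mu}(j)-1)\,[1-e(jb)].$$
   Context: The unit circle $\mathbb{T}$ is identified with $[0,1)$. For real $x$, $e(x)=\exp(2\pi i x)$. For a complex number $z$, $\Im(z)$ is its imaginary part. The Fourier coefficients of a finite Borel measure $\mu$ on $\mathbb{T}$ are $\hat{\mu}(n)=\int_{\mathbb{T}} e(-nx)\,d\mu(x)$, $n\in\mathbb{Z}$. $\mu[a,b)$ denotes the $\mu$-measure of the arc $[a,b)\subset[0,1)$. Infinite series $\sum_{n=1}^\infty$ are limits of the partial sums $\sum_{n=1}^N$ as $N\to\infty$. *)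

(* Defs.v *)
From HB Require Import structures.
From mathcomp Require Import all_boot all_order all_algebra.
From mathcomp Require Import complex.
From mathcomp Require Import all_classical all_reals all_analysis.

Set Implicit Arguments.
Unset Strict Implicit.
Unset Printing Implicit Defensive.

Import Order.TTheory GRing.Theory Num.Theory.
Import numFieldNormedType.Exports.

Local Open Scope classical_set_scope.
Local Open Scope ring_scope.
Local Open Scope complex_scope.

(* The unit circle, identified with [0, 1). The quotient map R -> R/Z restricts
   to a Borel isomorphism from [0, 1) onto R/Z, so the Borel sigma-algebra of
   the circle is the trace on [0, 1) of the Borel sigma-algebra of R. *)
Definition circle (R : realType) : Type := `[0%R, 1%R[%classic : set R.

Definition circle_val (R : realType) (x : circle R) : R := set_val x.

Lemma circle0_subproof (R : realType) : (0 : R) \in (`[0%R, 1%R[%classic : set R).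
Proof. by apply/mem_set; rewrite /= in_itv /= lexx ltr01. Qed.

HB.instance Definition _ (R : realType) := gen_eqMixin (circle R).
HB.instance Definition _ (R : realType) := gen_choiceMixin (circle R).
HB.instance Definition _ (R : realType) :=
  isPointed.Build (circle R) (exist _ 0 (circle0_subproof R)).
HB.instance Definition _ (R : realType) := Measurable.copy (circle R)
  (g_sigma_algebra_preimageType (@circle_val R)).

Definition circle_arc (R : realType) (a b : R) : set (circle R) :=
  [set x | a <= circle_val x < b].

Definition cexp (R : realType) (z : R[i]) : R[i] :=
  (expR (complex.Re z))%:C * (cos (complex.Im z) +i* sin (complex.Im z)).

Definition e (R : realType) (x : R) : R[i] := cexp (2 * pi%:C * 'i * x%:C).

Definition cintegral d (T : measurableType d) (R : realType)
    (mu : {measure set T -> \bar R}) (f : T -> R[i]) : R[i] :=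
  (\int[mu]_x complex.Re (f x)) +i* (\int[mu]_x complex.Im (f x)).

Definition fourier_coeff (R : realType)
    (mu : {finite_measure set (circle R) -> \bar R}) (n : int) : R[i] :=
  cintegral mu (fun x => e (- n%:~R * circle_val x)).

(* Main.v *)
Require Import Defs.
From HB Require Import structures.
From mathcomp Require Import all_boot all_order all_algebra.
From mathcomp Require Import complex.
From mathcomp Require Import all_classical all_reals all_analysis.
From mathcomp Require Import measurable_realfun ring lra.

Set Implicit Arguments.
Unset Strict Implicit.
Unset Printing Implicit Defensive.

Import Order.TTheory GRing.Theory Num.Theory.
Import numFieldNormedType.Exports.

Local Open Scope classical_set_scope.
Local Open Scope ring_scope.
Local Open Scope complex_scope.

(** Let nu be the signed measure mu - delta_0.  Its Fourier coefficients are
    fourier_coeff mu n - 1, so that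
      (fourier_coeff mu n - 1) (e(nb) - e(na))
        = int [e(n(b - x)) - e(n(a - x))] dnu(x).
    Both sequences of the theorem are therefore integrals against nu of
    differences K_N(b - x) - K_N(a - x), where K_N is one of the explicit kernels
      s_N(t) = sum_(1 <= n <= N) sin(2 pi n t) / n   (the Fourier series),
      E_N(t) = N^-1 sum_(1 <= j <= N) e(jt)          (the Cesaro means).
    As a, b lie in [0, 1] and x in [0, 1[, only t in ]-1, 1] matters.  There both
    kernels are bounded uniformly in N and converge pointwise:
      s_N(t) --> pi (1_{t > 0} - 1/2 - t + 1_{t integer} / 2),
      E_N(t) --> 1_{t integer}.
    By bounded convergence the integrals converge to those of the limits.  In the
    combination s_N / pi - E_N / 2 the two terms in 1_{t integer} cancel: the
    averages repair the midpoint value that a Fourier series takes at a jump, and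
    the limit is 1_{t > 0} - 1/2 - t.  Its difference between b - x and a - x is
    1_[a, b[(x) plus the constant a - b, which nu annihilates since nu has total
    mass 0.  What is left is nu[a, b[ = mu[a, b[ - 1_{a = 0}, which contains both
    formulas: the leading 1 of the second one is delta_0[0, b[.

    The substantial point is the bounded convergence of s_N.  Written in the half
    angle x = pi t, sum sin(2nx) / n and pi / 2 - x agree at pi / 2 and their
    difference has the Dirichlet kernel sin((2N + 1)x) / sin x as derivative.
    [sine_sum_error_half] integrates it by parts once, which bounds the difference
    by 2 / ((2N + 1) sin x).  For x within about 1 / N of 0, where this is useless,
    |sin(kx)| <= k |sin x| gives the uniform bound directly.  The estimates live in
    [sine_sum_error], [sine_sum_bounded] and [cvg_cos_mean], the passage to
    integrals in [fourier_coeff_sub1_mul] and [cvg_arc_int], and the cancellation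
    in [arc_diff_limits]. *)

(** * A mean value inequality *)

(** The functions g + f and g - f are both nondecreasing. It bounds the integral
    of f' by that of g' while integrating nothing. *)
Lemma variation_le_dominating (R : realType) (f g f' g' : R -> R) (a b : R) :
  a <= b ->
  (forall c, c \in `[a, b] -> is_derive c 1 f (f' c)) ->
  (forall c, c \in `[a, b] -> is_derive c 1 g (g' c)) ->
  (forall c, c \in `[a, b] -> `|f' c| <= g' c) ->
  `|f b - f a| <= g b - g a.
Proof.
move=> ab df dg f'g'.
have key (h h' : R -> R) : (forall c, c \in `[a, b] -> is_derive c 1 h (h' c)) ->
    (forall c, c \in `[a, b] -> 0 <= h' c) -> h a <= h b.
  move=> dh h'0.
  have d1 x : x \in `]a, b[ -> is_derive x 1 h (h' x).
    by move=> xab; apply: dh; exact: (@subset_itv_oo_cc _ _ a b x xab).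
  have d2 : {within `[a, b], continuous h}.
    by apply: derivable_within_continuous => x xab; have [] := dh x xab.
  have [c cab E] := MVT_segment ab d1 d2.
  by rewrite -subr_ge0 E mulr_ge0 ?h'0 ?subr_ge0.
have Hp : (g + f) a <= (g + f) b.
  apply: (key _ (fun c => g' c + f' c)) => c cab.
    by apply: is_deriveD; [exact: dg|exact: df].
  by have := f'g' c cab; rewrite ler_norml => /andP[]; lra.
have Hm : (g - f) a <= (g - f) b.
  apply: (key _ (fun c => g' c - f' c)) => c cab.
    by apply: is_deriveB; [exact: dg|exact: df].
  by have := f'g' c cab; rewrite ler_norml => /andP[]; lra.
move: Hp Hm; rewrite !fctE ler_norml => Hp Hm.
by apply/andP; split; lra.
Qed.

(** * Bounded convergence of the series of sin(2nx)/n *)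

Section SineSeries.
Variable R : realType.
Implicit Types (x t : R) (N n : nat).

Definition sine_sum N x : R := \sum_(1 <= n < N.+1) sin (2 * n%:R * x) / n%:R.

(** Closed form of the Dirichlet kernel, by telescoping
    2 sin x cos(2nx) = sin((2n + 1)x) - sin((2n - 1)x). *)
Lemma sin_mul_cos_sum N x :
  sin x * (1 + 2 * \sum_(1 <= n < N.+1) cos (2 * n%:R * x)) =
  sin ((2 * N%:R + 1) * x).
Proof.
elim: N => [|N IH];
  first by rewrite big_geq// !(mulr0, addr0, add0r, mulr1, mul1r).
rewrite big_nat_recr//= [2 * (_ + _)]mulrDr addrA [LHS]mulrDr IH.
have -> : (2 * N.+1%:R + 1) * x = 2 * N.+1%:R * x + x by ring.
have -> : (2 * N%:R + 1) * x = 2 * N.+1%:R * x - x by rewrite -natr1; ring.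
by rewrite sinB sinD; ring.
Qed.

Lemma sin_mul_sin_sum N x :
  2 * sin x * \sum_(1 <= n < N.+1) sin (2 * n%:R * x) =
  cos x - cos ((2 * N%:R + 1) * x).
Proof.
elim: N => [|N IH]; first by rewrite big_geq// !(mulr0, add0r, mul1r) subrr.
rewrite big_nat_recr//= mulrDr IH.
have -> : (2 * N.+1%:R + 1) * x = 2 * N.+1%:R * x + x by ring.
have -> : (2 * N%:R + 1) * x = 2 * N.+1%:R * x - x by rewrite -natr1; ring.
by rewrite cosB cosD; ring.
Qed.

Lemma is_derive_sin_scale k x :
  is_derive x 1 (fun y : R => sin (k * y)) (k * cos (k * x)).
Proof.
have h : is_derive x 1 ( *%R k) k.
  exact: is_derive_eq (is_deriveZ k (is_derive_id x (1 : R))) (mulr1 k).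
rewrite mulrC.
exact: (@is_derive1_comp _ sin ( *%R k) x).
Qed.

Lemma is_derive_cos_scale k x :
  is_derive x 1 (fun y : R => cos (k * y)) (- k * sin (k * x)).
Proof.
have h : is_derive x 1 ( *%R k) k.
  exact: is_derive_eq (is_deriveZ k (is_derive_id x (1 : R))) (mulr1 k).
apply: is_derive_eq (@is_derive1_comp _ cos ( *%R k) x _ _ (is_derive_cos _) h) _.
by rewrite mulNr mulrC mulNr.
Qed.

Lemma is_derive_sine_sum N x :
  is_derive x 1 (sine_sum N) (2 * \sum_(1 <= n < N.+1) cos (2 * n%:R * x)).
Proof.
have -> : sine_sum N = fun y => \sum_(1 <= n < N.+1) sin (2 * n%:R * y) / n%:R.
  by apply/funext.
elim: N => [|N IH].
  rewrite big_geq// mulr0.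
  by under eq_fun do rewrite big_geq//; exact: is_derive_cst.
under eq_fun do rewrite big_nat_recr//=.
rewrite big_nat_recr//= mulrDr; apply: is_deriveD => //.
have h := is_deriveZ (N.+1%:R^-1 : R) (is_derive_sin_scale (2 * N.+1%:R) x).
have -> : (fun y : R => sin (2 * N.+1%:R * y) / N.+1%:R) =
    N.+1%:R^-1 \*: (fun y => sin (2 * N.+1%:R * y)).
  by apply/funext => y /=; rewrite mulrC.
apply: is_derive_eq h _.
by rewrite /GRing.scale/= -mulrA mulrCA mulKf ?pnatr_eq0.
Qed.

Lemma cos_odd_pihalf N : cos ((2 * N%:R + 1) * (pi / 2)) = 0 :> R.
Proof.
elim: N => [|N IH]; first by rewrite !(mulr0, add0r, mul1r) cos_pihalf.
have -> : (2 * N.+1%:R + 1) * (pi / 2) = (2 * N%:R + 1) * (pi / 2) + pi :> R.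
  by rewrite -natr1; field.
by rewrite cosDpi IH oppr0.
Qed.

Lemma sin_natpi n : sin (n%:R * pi) = 0 :> R.
Proof.
elim: n => [|n IH]; first by rewrite mul0r sin0.
by rewrite -natr1 mulrDl mul1r sinDpi IH oppr0.
Qed.

Lemma sine_sum_pihalf N : sine_sum N (pi / 2) = 0.
Proof.
rewrite /sine_sum big1_seq// => n _.
have -> : 2 * n%:R * (pi / 2) = n%:R * pi :> R by field.
by rewrite sin_natpi mul0r.
Qed.

(** On [x, pi/2] the derivative sin(My) / sin y of the error, M = 2N + 1, is
    integrated by parts: adding cos(My) / (M sin y) to the error leaves the
    derivative - cos(My) cos y / (M sin^2 y). It is dominated by the derivative of
    - 1 / (M sin y), because cos y >= 0 on this half of ]0, pi[. Both terms vanish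
    at pi / 2, the second one because M is odd. *)
Lemma sine_sum_error_half N x : 0 < x <= pi / 2 ->
  `|sine_sum N x - (pi / 2 - x)| <= 2 / ((2 * N%:R + 1) * sin x).
Proof.
move=> /andP[x0 xpi].
set M : R := 2 * N%:R + 1.
have M0 : 0 < M by rewrite /M ltr_wpDl// mulr_ge0.
have s0 c : c \in `[x, (pi / 2)] -> 0 < sin c.
  rewrite in_itv/= => /andP[xc cpi]; apply: sin_gt0_pi.
  by rewrite (lt_le_trans x0 xc)/=; have := pi_gt0 R; lra.
have xx : x \in `[x, (pi / 2)] by rewrite in_itv/= lexx.
have sx0 := s0 x xx.
have dg c : c \in `[x, (pi / 2)] ->
    is_derive c 1 (fun y => - (M^-1 * (sin y)^-1)) (M^-1 * (cos c / sin c ^+ 2)).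
  move=> /s0 sc0.
  have h : is_derive c 1 (fun y => (sin y)^-1) (- sin c ^- 2 *: cos c).
    by apply: is_deriveV; rewrite gt_eqF.
  have h2 := is_deriveN (is_deriveZ M^-1 h).
  apply: is_derive_eq h2 _.
  by rewrite /GRing.scale/=; ring.
have dK c : c \in `[x, (pi / 2)] ->
    is_derive c 1 (fun y => sine_sum N y - (pi / 2 - y) +
                     M^-1 * (cos (M * y) * (sin y)^-1))
      (- (M^-1 * (cos (M * c) * cos c / sin c ^+ 2))).
  move=> /s0 sc0.
  have h : is_derive c 1 (fun y => (sin y)^-1) (- sin c ^- 2 *: cos c).
    by apply: is_deriveV; rewrite gt_eqF.
  have h1 := is_deriveZ M^-1 (is_deriveM (is_derive_cos_scale M c) h).
  have h2 := is_deriveB (is_derive_cst (pi / 2 : R) c 1) (is_derive_id c (1 : R)).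
  have h3 := is_deriveD (is_deriveB (is_derive_sine_sum N c) h2) h1.
  apply: is_derive_eq h3 _.
  have -> : 2 * \sum_(1 <= n < N.+1) cos (2 * n%:R * c) - (0 - 1) =
      sin (M * c) / sin c.
    by rewrite /M -sin_mul_cos_sum mulrAC mulfV ?gt_eqF//; ring.
  rewrite /GRing.scale/=; field.
  by rewrite !gt_eqF.
have bnd c : c \in `[x, (pi / 2)] ->
    `|- (M^-1 * (cos (M * c) * cos c / sin c ^+ 2))| <=
    M^-1 * (cos c / sin c ^+ 2).
  move=> cx; have sc := s0 c cx.
  have cc : 0 <= cos c.
    apply: cos_ge0_pihalf; move: cx; rewrite in_itv/= => /andP[xc ->].
    rewrite andbT (le_trans _ (ltW (lt_le_trans x0 xc)))//.
    by rewrite oppr_le0 divr_ge0 ?pi_ge0.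
  rewrite normrN 3!normrM normrV ?unitfE ?gt_eqF ?exprn_gt0//.
  rewrite normrV ?unitfE ?gt_eqF ?exprn_gt0//.
  rewrite (gtr0_norm M0) (ger0_norm cc) (gtr0_norm (exprn_gt0 _ sc)).
  rewrite ler_pM2l ?invr_gt0// ler_pM2r ?invr_gt0 ?exprn_gt0//.
  by rewrite ler_piMl// cos_max.
have := variation_le_dominating xpi dK dg bnd.
rewrite sine_sum_pihalf cos_odd_pihalf sin_pihalf subrr mul0r mulr0 addr0 !sub0r.
rewrite oppr0 opprK invr1 mulr1.
set u := sine_sum _ _ - _; set v := M^-1 * (cos _ * _); set w := M^-1 * _ => H.
have vw : `|v| <= w.
  rewrite /v /w !normrM !normrV ?unitfE ?gt_eqF// (gtr0_norm M0) (gtr0_norm sx0).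
  by rewrite ler_pM2l ?invr_gt0// ler_piMl ?cos_max// invr_ge0 ltW.
have -> : 2 / (M * sin x) = w + w.
  by rewrite /w; field; rewrite !gt_eqF.
have : 0 < M^-1 by rewrite invr_gt0.
move: H vw; rewrite !ler_norml => /andP[? ?] /andP[? ?] ?.
by apply/andP; split; lra.
Qed.

Lemma sine_sumN N x : sine_sum N (- x) = - sine_sum N x.
Proof.
by rewrite /sine_sum -sumrN; apply: eq_bigr => n _; rewrite mulrN sinN mulNr.
Qed.

Lemma sine_sum_reflect N x : sine_sum N (pi - x) = - sine_sum N x.
Proof.
rewrite /sine_sum -sumrN; apply: eq_bigr => n _.
have -> : 2 * n%:R * (pi - x) = - (2 * n%:R * x) + pi *+ 2 *+ n.
  by rewrite -mulr_natr -[pi *+ 2]mulr_natr; ring.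
by rewrite periodicn ?sinN ?mulNr//; exact: sinD2pi.
Qed.

(** The reflection x -> pi - x changes the sign of sine_sum N x and of pi / 2 - x
    and fixes sin x. *)
Lemma sine_sum_error N x : 0 < x < pi ->
  `|sine_sum N x - (pi / 2 - x)| <= 2 / ((2 * N%:R + 1) * sin x).
Proof.
move=> /andP[x0 xpi]; have [xh|hx] := leP x (pi / 2).
  by apply: sine_sum_error_half; rewrite x0.
have -> : sine_sum N x - (pi / 2 - x) =
    - (sine_sum N (pi - x) - (pi / 2 - (pi - x))).
  by rewrite sine_sum_reflect; field.
have -> : sin x = sin (pi - x) by rewrite sinB sinpi cospi; ring.
by rewrite normrN sine_sum_error_half//; apply/andP; split; lra.
Qed.

(** It serves near the zeros of sin, where the closed forms of the kernels
    degenerate, and at these zeros it yields sin(nx) = 0. *)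
Lemma norm_sin_nat_mul n x : `|sin (n%:R * x)| <= n%:R * `|sin x|.
Proof.
elim: n => [|n IH]; first by rewrite !mul0r sin0 normr0.
rewrite -natr1 !mulrDl !mul1r sinD (le_trans (ler_normD _ _))// !normrM.
apply: lerD; last by rewrite ler_piMl// cos_max.
by rewrite (le_trans _ IH)// ler_piMr// cos_max.
Qed.

Lemma sine_sum_le_sin N x : `|sine_sum N x| <= 2 * N%:R * `|sin x|.
Proof.
elim: N => [|N IH]; first by rewrite /sine_sum big_geq// normr0 mulr0 mul0r.
rewrite /sine_sum big_nat_recr//= (le_trans (ler_normD _ _))//.
have -> : 2 * N.+1%:R * `|sin x| = 2 * N%:R * `|sin x| + 2 * `|sin x|.
  by rewrite -(natr1 N); ring.
rewrite lerD// normrM normfV normr_nat ler_pdivrMr// [leRHS]mulrAC -natrM.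
exact: norm_sin_nat_mul.
Qed.

(** If (2N + 1) sin x >= 1 the error estimate gives 2 + pi/2 <= 4; otherwise the
    N terms, of size at most 2 sin x each, add up to less than 1. *)
Lemma sine_sum_bounded_half N x : 0 < x <= pi / 2 -> `|sine_sum N x| <= 4.
Proof.
move=> xI; have /andP[x0 xpi] := xI.
have sx0 : 0 < sin x.
  by apply: sin_gt0_pi; rewrite x0/=; have := pi_gt0 R; lra.
have N0 : 0 <= N%:R :> R by [].
have [M1|M1] := leP 1 ((2 * N%:R + 1) * sin x).
  have := sine_sum_error_half N xI.
  have : 2 / ((2 * N%:R + 1) * sin x) <= 2.
    by rewrite ler_pdivrMr ?(lt_le_trans _ M1)// ler_peMr.
  have := pihalf_lt2 R.
  move=> + + /le_trans H => ? /H.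
  by rewrite !ler_norml => /andP[? ?]; apply/andP; split; lra.
apply: le_trans (sine_sum_le_sin N x) _.
by rewrite (gtr0_norm sx0); lra.
Qed.

Lemma sine_sum_bounded N x : - pi <= x <= pi -> `|sine_sum N x| <= 4.
Proof.
suff key y : 0 <= y <= pi -> `|sine_sum N y| <= 4.
  move=> /andP[? ?]; have [x0|x0] := leP 0 x; first by apply: key; rewrite x0.
  by rewrite -normrN -sine_sumN key//; apply/andP; split; lra.
have z : `|sine_sum N 0| <= 4.
  by rewrite (le_trans (sine_sum_le_sin _ _))// sin0 normr0 mulr0.
move=> /andP[]; rewrite le_eqVlt => /predU1P[<-//|y0 ypi].
have [yh|hy] := leP y (pi / 2); first by rewrite sine_sum_bounded_half ?y0.
rewrite -normrN -sine_sum_reflect.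
move: ypi; rewrite le_eqVlt => /predU1P[->|ypi]; first by rewrite subrr.
by rewrite sine_sum_bounded_half//; apply/andP; split; lra.
Qed.

Lemma cvg_of_error_le (u : R^nat) (l C : R) :
  (forall n, `|u n - l| <= C / n.+1%:R) -> u @ \oo --> l.
Proof.
move=> ul; apply/cvgrPdist_le => eps eps0.
have h : C / n.+1%:R @[n --> \oo] --> (0 : R).
  rewrite -[X in _ --> X](mulr0 C).
  by apply: cvgMr; exact: cvg_harmonic.
have /cvgrPdist_le/(_ _ eps0) := h; apply: filterS => n.
rewrite sub0r normrN => H; rewrite distrC.
exact: le_trans (ul n) (le_trans (ler_norm _) H).
Qed.

Lemma cvg_sine_sum x : 0 < x < pi -> sine_sum ^~ x @ \oo --> pi / 2 - x.
Proof.
move=> xI; have sx0 := sin_gt0_pi xI.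
apply: (@cvg_of_error_le _ _ (2 / sin x)) => N.
apply: le_trans (sine_sum_error N xI) _.
rewrite invfM mulrA mulrAC ler_pM2l ?divr_gt0// lef_pV2 ?posrE//.
by rewrite -natr1 lerD2r ler_peMl// ler1n.
Qed.

(** The sum of the series at x = pi t for t in ]-1, 1]. The condition
    sin (pi t) = 0 says that t is an integer; there the sum is the midpoint of
    the jump. *)
Definition jump_limit t : R :=
  pi * ((0 < t)%R%:R - 2^-1 - t + (sin (pi * t) == 0)%R%:R / 2).

Lemma cvg_sine_sum_jump t : - 1 < t <= 1 ->
  sine_sum ^~ (pi * t) @ \oo --> jump_limit t.
Proof.
move=> /andP[t_gtN1 t_le1].
have pi0 := pi_gt0 R.
have ev x : sin x = 0 -> sine_sum ^~ x = cst 0.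
  move=> sx; apply/funext => N; apply/eqP; rewrite -normr_le0.
  by rewrite (le_trans (sine_sum_le_sin N x))// sx normr0 mulr0.
have main (s : R) : 0 < s < 1 -> 0 < pi * s < pi.
  move=> /andP[s0 s1]; rewrite mulr_gt0//=.
  by rewrite gtr_pMr.
rewrite /jump_limit; case: (ltgtP t 0) => t0.
- have t1 : 0 < - t < 1 by apply/andP; split; lra.
  have s0 := sin_gt0_pi (main _ t1).
  rewrite mulrN sinN in s0.
  rewrite lt_eqF; last by rewrite -oppr_gt0.
  have -> : pi * (0%:R - 2^-1 - t + 0%:R / 2) = - (pi / 2 - pi * (- t)) by ring.
  have -> : sine_sum ^~ (pi * t) = - (sine_sum ^~ (pi * (- t))).
    by apply/funext => N; rewrite fctE mulrN sine_sumN opprK.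
  by apply: cvgN; apply: cvg_sine_sum; exact: main.
- move: t_le1; rewrite le_eqVlt => /predU1P[->|t1].
    rewrite mulr1 sinpi eqxx ev ?sinpi//.
    have -> : pi * (1 - 2^-1 - 1 + 1 / 2) = 0 :> R by field.
    exact: cvg_cst.
  have t1' : 0 < t < 1 by rewrite t0.
  rewrite gt_eqF; last exact: sin_gt0_pi (main _ t1').
  have -> : pi * (1 - 2^-1 - t + 0%:R / 2) = pi / 2 - pi * t by field.
  by apply: cvg_sine_sum; exact: main.
- rewrite t0 mulr0 sin0 eqxx ev ?sin0//.
  have -> : pi * (0%:R - 2^-1 - 0 + 1 / 2) = 0 :> R by field.
  exact: cvg_cst.
Qed.

(** * Averages of exponentials *)

Definition cos_mean N x : R := N%:R^-1 * \sum_(1 <= n < N.+1) cos (2 * n%:R * x).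
Definition sin_mean N x : R := N%:R^-1 * \sum_(1 <= n < N.+1) sin (2 * n%:R * x).

Lemma norm_mean_le1 N (u : R^nat) : (forall n, `|u n| <= 1) ->
  `|N%:R^-1 * \sum_(1 <= n < N.+1) u n| <= 1.
Proof.
move=> u1; rewrite normrM normfV normr_nat.
case: N => [|N]; first by rewrite invr0 mul0r.
rewrite mulrC ler_pdivrMr// mul1r (le_trans (ler_norm_sum _ _ _))//.
rewrite (le_trans (ler_sum _ (fun i _ => u1 i)))//.
by rewrite big_const_nat iter_addr_0 subn1.
Qed.

Lemma cvg_mean0 (u : R^nat) C :
  (forall N, `|\sum_(1 <= n < N.+1) u n| <= C) ->
  N%:R^-1 * (\sum_(1 <= n < N.+1) u n) @[N --> \oo] --> (0 : R).
Proof.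
move=> uC; apply: (@cvg_of_error_le _ _ (2 * C)) => N.
have C0 : 0 <= C by exact: le_trans (uC 0%N).
rewrite subr0 normrM normfV normr_nat.
case: N => [|N]; first by rewrite invr0 mul0r mulr_ge0// mulr_ge0.
rewrite [2 * C]mulrC -mulrA [leRHS]mulrC ler_pM//.
rewrite ler_pdivlMr// mulrC ler_pdivrMr// -natrM ler_nat.
by rewrite mul2n -addnn addnS ltnS leq_addr.
Qed.

(** Off the zeros of sin the sums are bounded by 1 / |sin x|, uniformly in N. *)
Lemma cvg_sin_mean x : sin_mean ^~ x @ \oo --> (0 : R).
Proof.
have [s0|s0] := eqVneq (sin x) 0.
  apply: (@cvg_mean0 _ 0) => N; rewrite big1 ?normr0// => n _.
  apply/eqP; rewrite -normr_le0 -natrM (le_trans (norm_sin_nat_mul _ _))//.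
  by rewrite s0 normr0 mulr0.
apply: (@cvg_mean0 _ (`|sin x|^-1)) => N.
rewrite -[leLHS](mulKf (_ : 2 * `|sin x| != 0)) ?mulf_neq0 ?normr_eq0//.
rewrite invfM mulrC -[leRHS]mul1r mulrA ler_pM2r ?invr_gt0 ?normr_gt0//.
rewrite ler_pdivrMr// mul1r -{1}(@ger0_norm _ 2)// -!normrM sin_mul_sin_sum.
by rewrite (le_trans (ler_normB _ _))// (le_trans (lerD (cos_max _) (cos_max _))).
Qed.

(** If sin x = 0 all the terms equal 1; otherwise the sums stay bounded. This is
    how averaging detects integers, hence atoms of a measure. *)
Lemma cvg_cos_mean x : cos_mean ^~ x @ \oo --> ((sin x == 0)%R%:R : R).
Proof.
have [s0|s0] := eqVneq (sin x) 0.
  apply: (@cvg_of_error_le _ _ 1) => N.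
  rewrite /cos_mean (eq_bigr (fun=> 1)); last first.
    move=> n _; have : sin (n%:R * x) = 0.
      apply/eqP; rewrite -normr_le0 (le_trans (norm_sin_nat_mul _ _))//.
      by rewrite s0 normr0 mulr0.
    rewrite -mulrA [2 * _](mulr_natl _ 2) cos_mulr2n => /eqP.
    rewrite -norm_cos_eq1 => /eqP h.
    by rewrite -real_normK ?num_real// h expr1n; ring.
  rewrite big_const_nat iter_addr_0 subn1/=.
  (* The mean over no term is 0 at N = 0, hence the separate case. *)
  case: N => [|N]; first by rewrite mulr0 sub0r normrN normr1 divr1.
  by rewrite mulVf ?pnatr_eq0// subrr normr0 divr_ge0.
apply: (@cvg_mean0 _ (`|sin x|^-1)) => N.
have E : 2 * \sum_(1 <= n < N.+1) cos (2 * n%:R * x) =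
    sin ((2 * N%:R + 1) * x) / sin x - 1.
  by rewrite -sin_mul_cos_sum; field.
have H : `|2 * \sum_(1 <= n < N.+1) cos (2 * n%:R * x)| <= 2 * `|sin x|^-1.
  rewrite E (le_trans (ler_normB _ _))// normr1 [leRHS]mulr_natl mulr2n lerD//.
    by rewrite normrM normfV ler_piMl// sin_max.
  by rewrite invf_ge1 ?normr_gt0// sin_max.
by move: H; rewrite normrM ger0_norm// ler_pM2l.
Qed.

End SineSeries.

(** * Integration of bounded functions *)

Section BoundedIntegrands.
Context d (T : measurableType d) (R : realType).
Variable mu : {finite_measure set T -> \bar R}.

Lemma integrable_of_bounded (f : T -> R) (C : R) :
  measurable_fun setT f -> (forall x, `|f x| <= C) ->
  mu.-integrable setT (EFin \o f).
Proof.
move=> mf fC; apply: measurable_bounded_integrable => //.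
  by rewrite ltey_eq fin_num_measure.
exists C; split; first exact: num_real.
by move=> y Cy x _; exact: le_trans (fC x) (ltW Cy).
Qed.

Lemma Rintegral_sum (I : Type) (s : seq I) (F : I -> T -> R) :
  (forall i, mu.-integrable setT (EFin \o F i)) ->
  \int[mu]_x (\sum_(i <- s) F i x) = \sum_(i <- s) \int[mu]_x F i x.
Proof.
move=> iF; elim: s => [|i s IH].
  rewrite big_nil; under eq_Rintegral do rewrite big_nil.
  by rewrite Rintegral_cst// mul0r.
rewrite big_cons -IH -RintegralD//; last first.
  have := @integrable_sum _ _ _ mu setT measurableT I s xpredT _ (fun i _ => iF i).
  by apply: eq_integrable => // x _ /=; rewrite sumEFin.
by under eq_Rintegral do rewrite big_cons.
Qed.

Lemma Rintegral_indic (A : set T) : measurable A ->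
  \int[mu]_x (\1_A x) = fine (mu A).
Proof. by move=> mA; rewrite /Rintegral integral_indic// setIT. Qed.

Lemma bounded_convergence (f_ : (T -> R)^nat) (f : T -> R) (C : R) :
  (forall n, measurable_fun setT (f_ n)) ->
  (forall n x, `|f_ n x| <= C) ->
  (forall x, f_ ^~ x @ \oo --> f x) ->
  mu.-integrable setT (EFin \o f) /\
  (\int[mu]_x f_ n x) @[n --> \oo] --> \int[mu]_x f x.
Proof.
move=> mf_ f_C f_f.
have mf : measurable_fun setT f.
  by apply: (measurable_fun_cvg mf_) => x _; exact: f_f.
have intC : mu.-integrable setT (EFin \o cst C).
  exact: finite_measure_integrable_cst.
have [||||intf _ cvf] := @dominated_convergence _ _ _ mu setT measurableT
  (fun n => EFin \o f_ n) (EFin \o f) (EFin \o cst C) _ _ _ intC _.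
- by move=> n; exact/measurable_EFinP.
- exact/measurable_EFinP.
- by apply: aeW => x _; apply: cvg_EFin (f_f x); exact: nearW.
- by apply: aeW => x n _; rewrite /= lee_fin.
split=> //; apply: fine_cvg.
rewrite /Rintegral fineK; first exact: cvf.
exact: integrable_fin_num.
Qed.

End BoundedIntegrands.

Lemma cvg_complex (R : realType) (u v : R^nat) (l m : R) :
  u @ \oo --> l -> v @ \oo --> m ->
  (fun n => u n +i* v n : R[i]^o) @ \oo --> (l +i* m : R[i]^o).
Proof.
move=> ul vm; apply/cvgrPdist_lt => -[eps eps'] eps0.
have [e'0 e0] : eps' = 0 /\ 0 < eps.
  by move: eps0; rewrite ltcE/= => /andP[/eqP].
rewrite {}e'0 {eps' eps0}.
have e20 : 0 < eps / 2 by rewrite divr_gt0.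
move/cvgrPdist_lt : ul => /(_ _ e20) ul; move/cvgrPdist_lt : vm => /(_ _ e20) vm.
near=> n.
have un : `|l - u n| < eps / 2 by near: n.
have vn : `|m - v n| < eps / 2 by near: n.
have -> : (l +i* m) - (u n +i* v n) = (l - u n)%:C + 'i%C * (m - v n)%:C.
  by apply/eqP; rewrite eq_complex /=; apply/andP; split; apply/eqP; ring.
apply: le_lt_trans (ler_normD _ _) _.
rewrite normrM !normc_def/= !expr0n/= !addr0 add0r expr1n sqrtr1 mul1r.
rewrite -rmorphD/= ltcR !sqrtr_sqr.
by rewrite (splitr eps) ltrD.
Unshelve. all: by end_near. Qed.

(** * Trigonometric sums as integrals over the circle *)

Section Circle.
Variable R : realType.
Implicit Types (a b t : R) (x : circle R) (phi : R -> R).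

Lemma measurable_circle_val : measurable_fun setT (@circle_val R).
Proof.
by move=> _ B mB; exists B.
Qed.

Lemma circle_valP x : 0 <= circle_val x < 1.
Proof. by have := set_valP x; rewrite /= in_itv. Qed.

Lemma measurable_circle_arc a b : measurable (circle_arc a b).
Proof.
exists `[a, b[%classic => //.
by rewrite setTI; apply/seteqP; split=> x /=; rewrite in_itv.
Qed.

Lemma eE t : e t = cos (2 * (pi * t)) +i* sin (2 * (pi * t)).
Proof.
rewrite /e /cexp.
have -> : 2 * pi%:C * 'i * t%:C = 0 +i* (2 * (pi * t)).
  have -> : (2 : R[i]) = (2 : R)%:C by rewrite rmorph_nat.
  by apply/eqP; rewrite eq_complex /=; apply/andP; split; apply/eqP; ring.
by rewrite /= expR0 mul1r.
Qed.

(** Integrating over mu the difference phi (b - x) - phi (a - x) from which its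
    value at x = 0 is subtracted amounts to integrating the difference against
    mu - delta_0, as mu has mass 1. *)
Definition arc_diff phi a b x : R :=
  phi (b - circle_val x) - phi (a - circle_val x) - (phi b - phi a).

Variable mu : probability (circle R) R.

Definition arc_int phi a b : R := \int[mu]_x arc_diff phi a b x.

Lemma measurable_arc_diff phi a b : measurable_fun setT phi ->
  measurable_fun setT (arc_diff phi a b).
Proof.
move=> mphi; apply: measurable_funB => //; apply: measurable_funB.
  by apply: measurableT_comp => //; apply: measurable_funB => //;
    exact: measurable_circle_val.
by apply: measurableT_comp => //; apply: measurable_funB => //;
  exact: measurable_circle_val.
Qed.

Lemma norm_arc_diff_le phi a b x C : 0 <= a <= 1 -> 0 <= b <= 1 ->
  (forall t, - 1 < t <= 1 -> `|phi t| <= C) -> `|arc_diff phi a b x| <= 4 * C.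
Proof.
move=> /andP[a0 a1] /andP[b0 b1] phiC; have /andP[x0 x1] := circle_valP x.
have H1 : `|phi (b - circle_val x)| <= C by apply: phiC; apply/andP; split; lra.
have H2 : `|phi (a - circle_val x)| <= C by apply: phiC; apply/andP; split; lra.
have H3 : `|phi b| <= C by apply: phiC; apply/andP; split; lra.
have H4 : `|phi a| <= C by apply: phiC; apply/andP; split; lra.
rewrite /arc_diff; move: H1 H2 H3 H4; rewrite !ler_norml.
move=> /andP[? ?] /andP[? ?] /andP[? ?] /andP[? ?].
by apply/andP; split; lra.
Qed.

Lemma integrable_arc_diff phi a b C : 0 <= a <= 1 -> 0 <= b <= 1 ->
  measurable_fun setT phi -> (forall t, - 1 < t <= 1 -> `|phi t| <= C) ->
  mu.-integrable setT (EFin \o arc_diff phi a b).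
Proof.
move=> aI bI mphi phiC; apply: (@integrable_of_bounded _ _ _ _ _ (4 * C)).
  exact: measurable_arc_diff.
by move=> x; exact: norm_arc_diff_le.
Qed.

Lemma arc_intZ phi a b C k : 0 <= a <= 1 -> 0 <= b <= 1 ->
  measurable_fun setT phi -> (forall t, - 1 < t <= 1 -> `|phi t| <= C) ->
  arc_int (fun t => k * phi t) a b = k * arc_int phi a b.
Proof.
move=> aI bI mphi phiC; rewrite /arc_int -RintegralZl//; last first.
  exact: integrable_arc_diff phiC.
by apply: eq_Rintegral => x _; rewrite /arc_diff; ring.
Qed.

Lemma arc_int_sum (I : Type) (s : seq I) (phi : I -> R -> R) a b C :
  0 <= a <= 1 -> 0 <= b <= 1 -> (forall i, measurable_fun setT (phi i)) ->
  (forall i t, - 1 < t <= 1 -> `|phi i t| <= C) ->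
  arc_int (fun t => \sum_(i <- s) phi i t) a b = \sum_(i <- s) arc_int (phi i) a b.
Proof.
move=> aI bI mphi phiC; rewrite /arc_int -Rintegral_sum; last first.
  by move=> i; exact: integrable_arc_diff (phiC i).
by apply: eq_Rintegral => x _; rewrite /arc_diff !sumrB.
Qed.

Lemma cvg_arc_int (phi_ : (R -> R)^nat) phi a b C : 0 <= a <= 1 -> 0 <= b <= 1 ->
  (forall n, measurable_fun setT (phi_ n)) ->
  (forall n t, - 1 < t <= 1 -> `|phi_ n t| <= C) ->
  (forall t, - 1 < t <= 1 -> phi_ ^~ t @ \oo --> phi t) ->
  mu.-integrable setT (EFin \o arc_diff phi a b) /\
  arc_int (phi_ n) a b @[n --> \oo] --> arc_int phi a b.
Proof.
move=> aI bI mphi phiC cvphi.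
apply: (@bounded_convergence _ _ _ _ (fun n => arc_diff (phi_ n) a b) _ (4 * C)).
- by move=> n; exact: measurable_arc_diff.
- by move=> n x; apply: norm_arc_diff_le => // t; exact: phiC.
- move=> x; have /andP[x0 x1] := circle_valP x.
  move/andP : aI => [a0 a1]; move/andP : bI => [b0 b1].
  by apply: cvgB; apply: cvgB; apply: cvphi; apply/andP; split; lra.
Qed.

Lemma measurable_cos_scale k : measurable_fun setT (fun t : R => cos (k * (pi * t))).
Proof.
by apply: measurableT_comp; [exact: continuous_measurable_fun (@continuous_cos R)|
  apply: measurable_funM => //; apply: measurable_funM].
Qed.

Lemma measurable_sin_scale k : measurable_fun setT (fun t : R => sin (k * (pi * t))).
Proof.
by apply: measurableT_comp; [exact: continuous_measurable_fun (@continuous_sin R)|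
  apply: measurable_funM => //; apply: measurable_funM].
Qed.

(** The factor fourier_coeff mu n - 1 is the Fourier coefficient of
    mu - delta_0, and multiplying it by e(nt) translates the integrand to
    e(n(t - x)). *)
Lemma fourier_coeff_sub1_mul (n : nat) a b :
  (fourier_coeff mu n - 1) * (e (n%:R * b) - e (n%:R * a)) =
  arc_int (fun t => cos (2 * n%:R * (pi * t))) a b +i*
  arc_int (fun t => sin (2 * n%:R * (pi * t))) a b.
Proof.
set c := fun t : R => cos (2 * n%:R * (pi * t)).
set s := fun t : R => sin (2 * n%:R * (pi * t)).
have ic : mu.-integrable setT (EFin \o (c \o @circle_val R)).
  apply: (@integrable_of_bounded _ _ _ _ _ 1) => [|x]; last exact: cos_max.
  by apply: measurableT_comp measurable_circle_val; exact: measurable_cos_scale.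
have is_ : mu.-integrable setT (EFin \o (s \o @circle_val R)).
  apply: (@integrable_of_bounded _ _ _ _ _ 1) => [|x]; last exact: sin_max.
  by apply: measurableT_comp measurable_circle_val; exact: measurable_sin_scale.
pose Ic := \int[mu]_x c (circle_val x); pose Is := \int[mu]_x s (circle_val x).
have lin p q r : \int[mu]_x (p * c (circle_val x) + q * s (circle_val x) - r) =
    p * Ic + q * Is - r.
  have ipc : mu.-integrable setT (EFin \o (fun x => p * c (circle_val x))).
    exact: (integrableZl _ _ ic).
  have iqs : mu.-integrable setT (EFin \o (fun x => q * s (circle_val x))).
    exact: (integrableZl _ _ is_).
  rewrite RintegralB//; last exact: finite_measure_integrable_cst.
    rewrite RintegralD// !RintegralZl// Rintegral_cst//.
    rewrite [fine _](_ : _ = 1) ?mulr1//.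
    exact: (congr1 fine (probability_setT mu)).
  exact: (integrableD _ ipc iqs).
have -> : arc_int c a b = (c b - c a) * Ic + (s b - s a) * Is - (c b - c a).
  rewrite -lin; apply: eq_Rintegral => x _; rewrite /arc_diff /c /s !mulrBr !cosB.
  ring.
have -> : arc_int s a b = (s b - s a) * Ic + (- (c b - c a)) * Is - (s b - s a).
  rewrite -lin; apply: eq_Rintegral => x _; rewrite /arc_diff /c /s !mulrBr !sinB.
  ring.
have -> : fourier_coeff mu n = Ic -i* Is.
  rewrite /fourier_coeff /cintegral; congr (_ +i* _).
    apply: eq_Rintegral => x _; rewrite eE/= -pmulrn /c.
    by rewrite -cosN; congr cos; ring.
  have -> : - Is = \int[mu]_x (0 * c (circle_val x) + (- 1) * s (circle_val x) - 0).
    by rewrite lin; ring.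
  apply: eq_Rintegral => x _; rewrite eE/= -pmulrn /s.
  by rewrite mul0r add0r subr0 mulN1r -sinN; congr sin; ring.
have en t : e (n%:R * t) = c t +i* s t.
  by rewrite eE /c /s; congr (cos _ +i* sin _); ring.
rewrite !en; apply/eqP; rewrite eq_complex /=.
by apply/andP; split; apply/eqP; ring.
Qed.

Lemma norm_sin_div_le1 (n : nat) (z : R) : `|sin (2 * n%:R * z) / n%:R| <= 1.
Proof.
rewrite normrM normfV normr_nat.
case: n => [|n]; first by rewrite invr0 mulr0.
by rewrite -[leRHS]mulr1 ler_pM ?sin_max ?invr_ge0 ?invf_le1 ?ler1n.
Qed.

Lemma sum_sine_eq_arc_int a b N : 0 <= a <= 1 -> 0 <= b <= 1 ->
  \sum_(1 <= n < N.+1) complex.Im ((fourier_coeff mu n - 1) / n%:R *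
    (e (n%:R * b) - e (n%:R * a))) =
  arc_int (fun t => sine_sum N (pi * t)) a b.
Proof.
move=> aI bI.
rewrite /sine_sum (@arc_int_sum _ _ (fun n t => sin (2 * n%:R * (pi * t)) / n%:R)
  a b 1) //; first last.
- by move=> n t _; exact: norm_sin_div_le1.
- move=> n; apply: measurable_funM => //; exact: measurable_sin_scale.
apply: eq_bigr => n _.
under [in RHS]eq_fun do rewrite mulrC.
rewrite (@arc_intZ _ _ _ 1)//; first last.
- by move=> t _; exact: sin_max.
- exact: measurable_sin_scale.
rewrite mulrAC fourier_coeff_sub1_mul.
have -> : (n%:R : R[i])^-1 = (n%:R^-1)%:C by rewrite fmorphV rmorph_nat.
by rewrite /= mulr0 add0r mulrC.
Qed.

Lemma mean_eq_arc_int a b N : 0 <= a <= 1 -> 0 <= b <= 1 ->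
  1 / (2 * N%:R) * \sum_(1 <= j < N.+1)
    (fourier_coeff mu j - 1) * (e (j%:R * b) - e (j%:R * a)) =
  (2^-1 * arc_int (fun t => cos_mean N (pi * t)) a b) +i*
  (2^-1 * arc_int (fun t => sin_mean N (pi * t)) a b).
Proof.
move=> aI bI.
rewrite (@arc_intZ (fun t => \sum_(1 <= n < N.+1) cos (2 * n%:R * (pi * t)))
  _ _ N%:R)//; first last.
- move=> t _; rewrite (le_trans (ler_norm_sum _ _ _))//.
  rewrite (le_trans (ler_sum _ (fun i _ => cos_max _)))//.
  by rewrite big_const_nat iter_addr_0 subn1.
- by apply: measurable_sum => n; exact: measurable_cos_scale.
rewrite (@arc_intZ (fun t => \sum_(1 <= n < N.+1) sin (2 * n%:R * (pi * t)))
  _ _ N%:R)//; first last.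
- move=> t _; rewrite (le_trans (ler_norm_sum _ _ _))//.
  rewrite (le_trans (ler_sum _ (fun i _ => sin_max _)))//.
  by rewrite big_const_nat iter_addr_0 subn1.
- by apply: measurable_sum => n; exact: measurable_sin_scale.
rewrite (@arc_int_sum _ _ (fun n t => cos (2 * n%:R * (pi * t))) _ _ 1)//; first last.
- by move=> n t _; exact: cos_max.
- by move=> n; exact: measurable_cos_scale.
rewrite (@arc_int_sum _ _ (fun n t => sin (2 * n%:R * (pi * t))) _ _ 1)//; first last.
- by move=> n t _; exact: sin_max.
- by move=> n; exact: measurable_sin_scale.
under eq_bigr do rewrite fourier_coeff_sub1_mul.
have sumC (u v : nat -> R) s : \sum_(j <- s) (u j +i* v j) =
    (\sum_(j <- s) u j) +i* (\sum_(j <- s) v j) :> R[i].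
  by elim/big_ind3 : _ => // x1 x2 _ y1 y2 _ -> ->.
rewrite sumC.
have -> : 1 / (2 * N%:R) = (2^-1 * N%:R^-1)%:C :> R[i].
  by rewrite div1r invfM rmorphM/= !fmorphV !rmorph_nat.
by apply/eqP; rewrite eq_complex /=; apply/andP; split; apply/eqP; ring.
Qed.

(** * The limit and its cancellation *)

Definition atom_limit t : R := (sin (pi * t) == 0)%R%:R.

(** Swapping a and b in the second term accounts for its sign in the theorem. The
    combination jump_limit / pi - atom_limit / 2 takes its left-hand limit at
    the integers, which is why the arc contains a and not b. *)
Lemma arc_diff_limits a b x : 0 <= a -> a < b -> b <= 1 ->
  1 / pi * arc_diff (@jump_limit R) a b x + 2^-1 * arc_diff atom_limit b a x =
  \1_(circle_arc a b) x - (a == 0)%R%:R.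
Proof.
move=> a0 ab b1; have /andP[x0 x1] := circle_valP x.
have jE t : 1 / pi * jump_limit t - 2^-1 * atom_limit t = (0 < t)%R%:R - 2^-1 - t.
  by rewrite /jump_limit div1r mulKf ?lt0r_neq0 ?pi_gt0// /atom_limit; ring.
have -> : 1 / pi * arc_diff (@jump_limit R) a b x + 2^-1 * arc_diff atom_limit b a x
   = (1 / pi * jump_limit (b - circle_val x) - 2^-1 * atom_limit (b - circle_val x))
   - (1 / pi * jump_limit (a - circle_val x) - 2^-1 * atom_limit (a - circle_val x))
   - ((1 / pi * jump_limit b - 2^-1 * atom_limit b)
   - (1 / pi * jump_limit a - 2^-1 * atom_limit a)).
  by rewrite /arc_diff; ring.
rewrite !jE !subr_gt0 (le_lt_trans a0 ab) indicE.
have -> : (x \in circle_arc a b) = (a <= circle_val x < b).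
  by apply/idP/idP => [/set_mem//|h]; exact: mem_set.
have -> : (0 < a) = (a != 0) by rewrite lt_neqAle a0 andbT eq_sym.
have [xa|ax] := ltP (circle_val x) a.
  by rewrite (lt_trans xa ab); case: eqP => _ /=; lra.
by case: ltP => _; case: eqP => _ /=; lra.
Qed.

(** Both formulas are instances: constants integrate to 0 against mu - delta_0, so
    only the mass of the arc survives, and delta_0 charges it exactly when a = 0. *)
Lemma circle_arc_fourier a b : 0 <= a -> a < b -> b <= 1 ->
  let S : nat -> R := fun N => \sum_(1 <= n < N.+1)
    complex.Im ((fourier_coeff mu n - 1) / n%:R *
                (e (n%:R * b) - e (n%:R * a))) in
  let A : nat -> R[i]^o := fun n => 1 / (2 * n%:R) *
    \sum_(1 <= j < n.+1)
      (fourier_coeff mu j - 1) * (e (j%:R * a) - e (j%:R * b)) in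
  [/\ cvgn S, cvgn A & (fine (mu (circle_arc a b)))%:C =
    ((a == 0)%R%:R)%:C + (1 / pi * limn S)%:C + limn A].
Proof.
move=> a0 ab b1 S A.
have aI : 0 <= a <= 1 by rewrite a0 (le_trans (ltW ab)).
have bI : 0 <= b <= 1 by rewrite b1 (le_trans a0 (ltW ab)).
have mscale (f : R -> R) : continuous f -> measurable_fun setT (fun t => f (pi * t)).
  move=> cf; apply: measurableT_comp; first exact: continuous_measurable_fun.
  exact: measurable_funM.
have [iJ cJ] : mu.-integrable setT (EFin \o arc_diff (@jump_limit R) a b) /\
    arc_int (fun t => sine_sum N (pi * t)) a b @[N --> \oo] -->
    arc_int (@jump_limit R) a b.
  apply: (@cvg_arc_int (fun N t => sine_sum N (pi * t)) _ _ _ 4) => //.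
  - move=> N; apply: mscale => y; apply/differentiable_continuous/derivable1_diffP.
    by have [] := is_derive_sine_sum N y.
  - move=> N t /andP[t0 t1]; apply: sine_sum_bounded.
    have := pi_gt0 R => pi0; rewrite -mulrN1 !ler_pM2l// (ltW t0)/=.
    by rewrite -[leRHS]mulr1 ler_pM2l.
  - by move=> t; exact: cvg_sine_sum_jump.
have [iC cC] : mu.-integrable setT (EFin \o arc_diff atom_limit b a) /\
    arc_int (fun t => cos_mean N (pi * t)) b a @[N --> \oo] -->
    arc_int atom_limit b a.
  apply: (@cvg_arc_int (fun N t => cos_mean N (pi * t)) _ _ _ 1) => //.
  - move=> N; apply: measurable_funM => //; apply: measurable_sum => n.
    exact: measurable_cos_scale.
  - by move=> N t _; apply: norm_mean_le1 => n; exact: cos_max.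
  - by move=> t _; exact: cvg_cos_mean.
have [_ cS] : mu.-integrable setT (EFin \o arc_diff (cst 0) b a) /\
    arc_int (fun t => sin_mean N (pi * t)) b a @[N --> \oo] -->
    arc_int (cst 0) b a.
  apply: (@cvg_arc_int (fun N t => sin_mean N (pi * t)) _ _ _ 1) => //.
  - move=> N; apply: measurable_funM => //; apply: measurable_sum => n.
    exact: measurable_sin_scale.
  - by move=> N t _; apply: norm_mean_le1 => n; exact: sin_max.
  - by move=> t _; exact: cvg_sin_mean.
have SE : S = fun N => arc_int (fun t => sine_sum N (pi * t)) a b.
  by apply/funext => N; exact: sum_sine_eq_arc_int.
have AE : A = fun N => (2^-1 * arc_int (fun t => cos_mean N (pi * t)) b a) +i*
    (2^-1 * arc_int (fun t => sin_mean N (pi * t)) b a).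
  by apply/funext => N; exact: mean_eq_arc_int.
have Slim : S @ \oo --> arc_int (@jump_limit R) a b by rewrite SE.
have Alim : A @ \oo --> ((2^-1 * arc_int atom_limit b a)%:C : R[i]^o).
  rewrite AE; apply: cvg_complex; first exact: cvgMr.
  have z : arc_int (cst 0) b a = 0.
    rewrite /arc_int -[RHS](mul0r (fine (mu setT))) -Rintegral_cst//.
    by apply: eq_Rintegral => x _; rewrite /arc_diff/= !subrr.
  by rewrite -[X in _ --> X](mulr0 2^-1) -z; exact: cvgMr.
split; [by apply/cvg_ex; eexists; exact: Slim|by apply/cvg_ex; eexists; exact: Alim|].
rewrite (cvg_lim _ Slim)// (cvg_lim _ Alim)//.
rewrite -!rmorphD/=; congr (_%:C).
rewrite -addrA /arc_int -!RintegralZl//.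
rewrite -RintegralD//; last 2 first.
- exact: (integrableZl _ _ iJ).
- exact: (integrableZl _ _ iC).
have mA := measurable_circle_arc a b.
have iA : mu.-integrable setT (EFin \o \1_(circle_arc a b)) by exact: integrable_indic.
under eq_Rintegral do rewrite arc_diff_limits//.
rewrite RintegralB//; last exact: finite_measure_integrable_cst.
rewrite Rintegral_indic// Rintegral_cst//.
rewrite [X in _ * X](_ : _ = 1); last exact: (congr1 fine (probability_setT mu)).
by rewrite mulr1 addrC subrK.
Qed.

End Circle.

Theorem theorem1p1 (R : realType) (mu : probability (circle R) R) :
  (forall a b : R, 0 < a -> a < b -> b <= 1 ->
    let S : nat -> R := fun N => \sum_(1 <= n < N.+1)
      complex.Im ((fourier_coeff mu n - 1) / n%:R *
                  (e (n%:R * b) - e (n%:R * a))) in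
    let A : nat -> R[i]^o := fun n => 1 / (2 * n%:R) *
      \sum_(1 <= j < n.+1)
        (fourier_coeff mu j - 1) * (e (j%:R * a) - e (j%:R * b)) in
    [/\ cvgn S, cvgn A &
        (fine (mu (circle_arc a b)))%:C = (1 / pi * limn S)%:C + limn A])
  /\
  (forall b : R, 0 < b -> b <= 1 ->
    let S : nat -> R := fun N => \sum_(1 <= n < N.+1)
      complex.Im ((fourier_coeff mu n - 1) / n%:R * (e (n%:R * b) - 1)) in
    let A : nat -> R[i]^o := fun n => 1 / (2 * n%:R) *
      \sum_(1 <= j < n.+1) (fourier_coeff mu j - 1) * (1 - e (j%:R * b)) in
    [/\ cvgn S, cvgn A &
        (fine (mu (circle_arc 0 b)))%:C = 1 + (1 / pi * limn S)%:C + limn A]).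
Proof.
split=> [a b a0 ab b1|b b0 b1].
  have [cS cA E] := circle_arc_fourier mu (ltW a0) ab b1.
  by split=> //; rewrite E gt_eqF// add0r.
have e0 (n : nat) : e (n%:R * 0 : R) = 1 by rewrite eE !mulr0 cos0 sin0.
move=> S A.
have [] := circle_arc_fourier mu (lexx 0) b0 b1.
set S0 := fun N : nat => _; set A0 := fun N : nat => _.
have -> : S0 = S by apply/funext => N; apply: eq_bigr => n _; rewrite e0.
have -> : A0 = A.
  by apply/funext => N; congr (_ * _); apply: eq_bigr => n _; rewrite e0.
by rewrite eqxx.
Qed.
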